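(* Let $k\ge2$ and let $Z_{nn}$ be a $k$-hidden-layer feedforward network on $\mathbb{R}^n$ whose activation functions are incrementally sector bounded by $[K_1^i,K_2^i]$, $i=1,\dots,k$. Let $\mathcal{C}\subseteq\mathcal{D}$ be a set on which the NODE system $\dot x_{nn}=Ax_{nn}+Z_{nn}(x_{nn})$ is forward complete and forward invariant. Consider the nonlinear system $\dot x=Ax+Z_{nn}(x)+\varepsilon(x)$ and put $\epsilon=\sup\|\varepsilon(x)\|$. Assume there is a subset $\mathcal{B}\subseteq\mathcal{C}$ such that for every $x(0)\in\mathcal{B}$ the trajectory $x(t)$ of this nonlinear system remains in $\mathcal{C}$ for all $t\ge0$, and that this system has an (unknown) equilibrium $x^*\in\mathcal{C}$, i.e. $Ax^*+Z_{nn}(x^* )+\varepsilon(x^* )=0$. Suppose there are a positive definite matrix $P\in\mathbb{R}^{n\times n}$ and positive constants $\underline{p},\overline{p},\gamma$ with $\underline{p}I\le P\le\overline{p}I$ and $$U_1^\top\begin{bmatrix}A^\top P+PA+\gamma P & PW^{k+1}\\ W^{(k+1)\top}P & 0\end{bmatrix}U_1+U_2^\top\begin{bmatrix}-2Q_1^\top Q_2 & Q_1^\top+Q_2^\top\\ Q_1+Q_2 & -2I\end{bmatrix}U_2\le0 .$$ Then for every initial condition $x(0)\in\mathcal{B}$, the trajectory of $\dot x=Ax+Z_{nn}(x)+\varepsilon(x)$ satisfies, for all $t\ge0$, $$\|x(t)-x^*\|\le\sqrt{\frac{\overline{p}}{\underline{p}}}\,\|x(0)-x^*\|e^{-\fr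ac{\gamma}{2}t}+\frac{4\epsilon}{\gamma}\sqrt{\frac{\overline{p}}{\underline{p}}}\,\bigl(1-e^{-\frac{\gamma}{2}t}\bigr).$$
   Context: Network. $n=m_0=m_{k+1}$, $A\in\mathbb{R}^{n\times n}$ is a constant matrix, and $\varepsilon:\mathbb{R}^n\to\mathbb{R}^n$ is an approximation error (of an unknown drift $f(x)=Ax+Z_{nn}(x)+\varepsilon(x)$, $x\in\mathcal{D}$). For input $x\in\mathbb{R}^n$: $w^0=x$, $w^{i+1}=\phi^{i+1}(W^{i+1}w^i+b^{i+1})$ for $i=0,\dots,k-1$, and $Z_{nn}(x)=W^{k+1}w^k+b^{k+1}$, with $W^{i+1}\in\mathbb{R}^{m_{i+1}\times m_i}$, $b^{i+1}\in\mathbb{R}^{m_{i+1}}$. Each $\phi^i:\mathbb{R}^{m_i}\to\mathbb{R}^{m_i}$ acts componentwise through differentiable scalar activation functions $\varphi^i_j$, $j=1,\dots,m_i$ (such as sigmoid or tanh). $\mathcal{D}\subseteq\mathbb{R}^n$ is a given set of states. The norm $\|\cdot\|$ represents some vector norm, or the corresponding induced matrix norm. Incremental sector bound $[K_1^i,K_2^i]$: $K_1^i=\mathrm{diag}(\alpha^i_1,\dots,\alpha^i_{m_i})$, $K_2^i=\mathrm{diag}(\beta^i_1,\dots,\beta^i_{m_i})$ with $\alpha^i_j\le\beta^i_j$ real, and $(\varphi^i_j(s)-\varphi^i_j(t)-\alpha^i_j(s-t))(\varphi^i_j(s)-\varphi^i_j(t)-\beta^i_j(s-t))\le0$ for all $s,t$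 among the values taken by the $j$-th component of $W^iw^{i-1}+b^i$ as the network input ranges over $\mathcal{D}$. Matrices. $Q_1=\mathrm{blockdiag}(K_1^1W^1,\dots,K_1^kW^k)$, $Q_2=\mathrm{blockdiag}(K_2^1W^1,\dots,K_2^kW^k)$; $a=\sum_{i=1}^{k-1}m_i$; $$U_1=\begin{bmatrix}I_n&0_{n\times a}&0_{n\times m_k}\\0_{m_k\times n}&0_{m_k\times a}&I_{m_k}\end{bmatrix},\qquad U_2=\begin{bmatrix}I_n&0_{n\times a}&0_{n\times m_k}\\0_{a\times n}&I_a&0_{a\times m_k}\\0_{a\times n}&I_a&0_{a\times m_k}\\0_{m_k\times n}&0_{m_k\times a}&I_{m_k}\end{bmatrix}.$$ Forward complete and forward invariant on $\mathcal{C}$: for any $x_{nn}(0)\in\mathcal{C}$ the trajectory exists and satisfies $x_{nn}(t)\in\mathcal{C}$ for all $t\ge0$. For symmetric matrices, $B\le C$ means $B-C$ is negative semidefinite.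
   Formalization: The norm, which the setting leaves as ''some vector norm'', is taken to be the Euclidean norm (also in the supremum defining ε, taken over D); for other norms, such as the max norm, the stated bound is false. *)

(* Defs.v *)
From HB Require Import structures.
From mathcomp Require Import all_boot all_order all_algebra.
From mathcomp Require Import all_classical all_reals all_analysis.

Set Implicit Arguments.
Unset Strict Implicit.
Unset Printing Implicit Defensive.

Import Order.TTheory GRing.Theory Num.Theory.
Import numFieldNormedType.Exports.

Local Open Scope classical_set_scope.
Local Open Scope ring_scope.

Definition enorm (R : realType) (n : nat) (v : 'cV[R]_n) : R :=
  Num.sqrt (\sum_(i < n) v i 0 ^+ 2).

(* Used for symmetric matrices only. *)
Definition mxle (R : realType) (n : nat) (B C : 'M[R]_n) : Prop :=
  forall v : 'cV[R]_n, (v^T *m (B - C) *m v) 0 0 <= 0.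

Definition posdef (R : realType) (n : nat) (P : 'M[R]_n) : Prop :=
  P^T = P /\ forall v : 'cV[R]_n, v != 0 -> 0 < (v^T *m P *m v) 0 0.

(* The network has widths m 0 = n, m 1, ..., m k, and output dimension m 0.
   Layer i < k maps w^i : 'cV_(m i) to w^(i+1) : 'cV_(m i.+1), so W i, b i,
   phi i, alpha i, beta i carry the mathematical superscript i + 1; the output
   layer Wout, bout carries the superscript k + 1. *)
Section Network.
Variables (R : realType) (m : nat -> nat).
Variables (W : forall i, 'M[R]_(m i.+1, m i)) (b : forall i, 'cV[R]_(m i.+1)).
Variable phi : forall i, 'I_(m i.+1) -> R -> R.

Definition preact (i : nat) (w : 'cV[R]_(m i)) : 'cV[R]_(m i.+1) :=
  W i *m w + b i.

Fixpoint hidden (x : 'cV[R]_(m 0%N)) (i : nat) : 'cV[R]_(m i) :=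
  if i is i'.+1 then \col_j phi j (preact (hidden x i') j 0) else x.

Definition network (k : nat) (Wout : 'M[R]_(m 0%N, m k)) (bout : 'cV[R]_(m 0%N))
    (x : 'cV[R]_(m 0%N)) : 'cV[R]_(m 0%N) :=
  Wout *m hidden x k + bout.

Definition inc_sector_bounded (k : nat) (D : set 'cV[R]_(m 0%N))
    (alpha beta : forall i, 'rV[R]_(m i.+1)) : Prop :=
  forall (i : nat) (j : 'I_(m i.+1)), (i < k)%N ->
    alpha i 0 j <= beta i 0 j /\
    forall s t : R,
      [set preact (hidden x i) j 0 | x in D] s ->
      [set preact (hidden x i) j 0 | x in D] t ->
      (phi j s - phi j t - alpha i 0 j * (s - t))
        * (phi j s - phi j t - beta i 0 j * (s - t)) <= 0.

End Network.

(* The ODE holds at every t >= 0, with the right derivative at t = 0. *)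
Definition trajectory (R : realType) (n : nat) (F : 'cV[R]_n -> 'cV[R]_n)
    (x : R -> 'cV[R]_n) : Prop :=
  (fun h : R => h^-1 *: (x h - x 0)) @ 0^'+ --> F (x 0) /\
  forall t : R, 0 < t -> is_derive t 1 x (F (x t)).

(* From every initial condition in B, a trajectory exists for all t >= 0 and
   stays in C. *)
Definition remains_in (R : realType) (n : nat) (F : 'cV[R]_n -> 'cV[R]_n)
    (B C : set 'cV[R]_n) : Prop :=
  forall x0 : 'cV[R]_n, B x0 ->
    (exists2 x, trajectory F x & x 0 = x0) /\
    (forall x, trajectory F x -> x 0 = x0 -> forall t : R, 0 <= t -> C (x t)).

Definition forward_complete_invariant (R : realType) (n : nat)
    (F : 'cV[R]_n -> 'cV[R]_n) (C : set 'cV[R]_n) : Prop :=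
  remains_in F C C.

Definition midsize (m : nat -> nat) (k : nat) : nat := (\sum_(1 <= i < k) m i)%N.

Lemma rows_size (m : nat -> nat) (k : nat) : (1 < k)%N ->
  (\sum_(i < k) m i.+1 = midsize m k + m k)%N.
Proof.
move=> k1; rewrite -(big_mkord xpredT (fun i => m i.+1)).
by rewrite -big_nat_recr ?(ltnW k1) // big_add1.
Qed.

Lemma cols_size (m : nat -> nat) (k : nat) : (1 < k)%N ->
  (\sum_(i < k) m i = m 0%N + midsize m k)%N.
Proof. by move=> k1; rewrite -(big_mkord xpredT m) big_ltn ?(ltnW k1). Qed.

(* blockdiag(B 0, ..., B (k-1)) with rectangular blocks. On the diagonal
   (i == j) the sizes agree and conform_mx only transports the type. *)
Definition rblockdiag (R : realType) (p q : nat -> nat)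
    (B : forall i, 'M[R]_(p i, q i)) (k : nat) :
    'M[R]_(\sum_(i < k) p i, \sum_(j < k) q j) :=
  \mxblock_(i < k, j < k)
    (if i == j then conform_mx (0 : 'M[R]_(p i, q j)) (B i) else 0).

Definition Qmx (R : realType) (m : nat -> nat) (k : nat) (k1 : (1 < k)%N)
    (W : forall i, 'M[R]_(m i.+1, m i)) (d : forall i, 'rV[R]_(m i.+1)) :
    'M[R]_(midsize m k + m k, m 0%N + midsize m k) :=
  castmx (rows_size m k1, cols_size m k1)
    (@rblockdiag R (fun i => m i.+1) m (fun i => diag_mx (d i) *m W i) k).

Definition U1mx (R : realType) (n a r : nat) : 'M[R]_(n + r, n + (a + r)) :=
  col_mx (row_mx 1%:M (row_mx 0 0))
         (row_mx 0    (row_mx 0 1%:M)).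

Definition U2mx (R : realType) (n a r : nat) :
    'M[R]_((n + a) + (a + r), n + (a + r)) :=
  col_mx (col_mx (row_mx 1%:M (row_mx 0    0))
                 (row_mx 0    (row_mx 1%:M 0)))
         (col_mx (row_mx 0    (row_mx 1%:M 0))
                 (row_mx 0    (row_mx 0    1%:M))).

(* Main.v *)
Require Import Defs.
From HB Require Import structures.
From mathcomp Require Import all_boot all_order all_algebra.
From mathcomp Require Import all_classical all_reals all_analysis.
From mathcomp Require Import ring lra.

(** Along a trajectory put [d = x - xs] and [V = d^T P d]. Let [z_i] be the
    difference of the [i]-th layers of the network at [x] and at [xs]. Evaluating
    the matrix inequality at [(d, z_1, ..., z_k)], its second term is [-2] times
    the sum over all neurons of the products in the sector bound, hence
    nonnegative; so the first term is nonpositive, and with it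
    [V' <= - gamma V + 2 d^T P (err x - err xs)]. Cauchy-Schwarz for [P] bounds
    the last summand by [4 eps sqrt pu sqrt V], a linear differential inequality
    for [sqrt V], and [pl |d|^2 <= V <= pu |d|^2] turns the bound on [sqrt V]
    into the bound on [|d|]. *)

Set Implicit Arguments.
Unset Strict Implicit.
Unset Printing Implicit Defensive.

Import Order.TTheory GRing.Theory Num.Theory.
Import numFieldNormedType.Exports.

Local Open Scope classical_set_scope.
Local Open Scope ring_scope.

(** * Stacked vectors and block matrices *)

(* Stacks of blocks whose sizes agree only propositionally are compared through
   their sequences of entries, on which castmx is invisible. *)
Definition entries (T : Type) (n : nat) (v : 'cV[T]_n) : seq T :=
  [seq v i 0 | i <- enum 'I_n].

Lemma entries_inj (T : Type) (n : nat) : injective (@entries T n).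
Proof.
move=> u v /eq_in_map uv; apply/colP => i.
by rewrite uv ?mem_enum.
Qed.

Lemma size_entries (T : Type) (n : nat) (v : 'cV[T]_n) : size (entries v) = n.
Proof. by rewrite size_map size_enum_ord. Qed.

Lemma entries_castmx (T : Type) (n n' : nat) (e : (n = n') * (1%N = 1%N))
    (v : 'cV[T]_n) :
  entries (castmx e v) = entries v.
Proof.
by case: e => e e1; case: n' / e; rewrite (eq_axiomK e1) castmx_id.
Qed.

Lemma enum_ord_add (p q : nat) :
  enum 'I_(p + q) =
  map (@lshift p q) (enum 'I_p) ++ map (@rshift p q) (enum 'I_q).
Proof.
apply: (inj_map val_inj); rewrite val_enum_ord map_cat iotaD.
congr (_ ++ _); rewrite -map_comp; first by rewrite -val_enum_ord; exact/eq_map.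
by rewrite add0n -[p in LHS]addn0 iotaDl -val_enum_ord -map_comp; exact/eq_map.
Qed.

Lemma entries_col_mx (T : Type) (p q : nat) (u : 'cV[T]_p) (v : 'cV[T]_q) :
  entries (col_mx u v) = entries u ++ entries v.
Proof.
rewrite /entries enum_ord_add map_cat.
by congr (_ ++ _); rewrite -map_comp; apply/eq_map => i /=;
  rewrite ?col_mxEu ?col_mxEd.
Qed.

Lemma entries_mxcol (T : Type) (k : nat) (p : 'I_k -> nat)
    (z : forall i, 'cV[T]_(p i)) :
  entries (\mxcol_i z i) = flatten [seq entries (z i) | i <- enum 'I_k].
Proof.
elim: k => [|k IH] in p z *.
  rewrite (size0nil (s := enum 'I_0)) ?size_enum_ord //=.
  by apply: size0nil; rewrite size_entries big_ord0.
rewrite mxcol_recu entries_castmx entries_col_mx IH enum_ordSl /=.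
by congr (_ ++ flatten _); rewrite -map_comp.
Qed.

(** The layers [0, ..., k-1] fed into the weights and the layers [1, ..., k] that come out share the
    layers [1, ..., k-1]. The witness [y] is this overlap, so the two stacks together are the vector
    that [U2mx] produces from [col_mx (z 0) (col_mx y (z k))]. *)
Lemma mxcol_stack_shift (R : realType) (m : nat -> nat) (k : nat) (k1 : (1 < k)%N)
    (z : forall i, 'cV[R]_(m i)) :
  exists y : 'cV[R]_(midsize m k),
    castmx (cols_size m k1, erefl) (\mxcol_(i < k) z i) = col_mx (z 0%N) y /\
    castmx (rows_size m k1, erefl) (\mxcol_(i < k) z i.+1) = col_mx y (z k).
Proof.
have iotaE (f : nat -> seq R) :
    [seq f (nat_of_ord i) | i <- enum 'I_k] = [seq f i | i <- iota 0 k].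
  by rewrite -val_enum_ord -map_comp.
set c := castmx _ (\mxcol_(i < k) z i.+1).
have ec : entries c =
    flatten [seq entries (z i) | i <- iota 1 k.-1] ++ entries (z k).
  rewrite entries_castmx entries_mxcol.
  rewrite (iotaE (fun i => entries (z i.+1))).
  have -> : [seq entries (z i.+1) | i <- iota 0 k] =
            [seq entries (z i) | i <- iota 1 k].
    by rewrite (iotaDl 1 0 k) -map_comp.
  have -> : iota 1 k = iota 1 k.-1 ++ [:: k].
    by rewrite -[k in LHS](prednK (ltnW k1)) -[k.-1.+1]addn1 iotaD add1n prednK ?(ltnW k1).
  by rewrite map_cat flatten_cat /= cats0.
have : entries (usubmx c) ++ entries (dsubmx c) = entries c.
  by rewrite -entries_col_mx vsubmxK.
(* The heads have equal length because the whole sequences do and both tails have length [m k]. *)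
rewrite ec => /eqP; rewrite eqseq_cat; last first.
  have := congr1 size ec.
  rewrite size_cat !size_entries.
  by move=> /eqP; rewrite eqn_add2r => /eqP.
move=> /andP[/eqP eu /eqP ed].
exists (usubmx c); split; last first.
  by rewrite -[LHS]vsubmxK -/c (entries_inj ed).
apply: entries_inj.
rewrite entries_castmx entries_mxcol (iotaE (fun i => entries (z i))).
rewrite entries_col_mx eu.
by rewrite -[in LHS](prednK (ltnW k1)).
Qed.

Lemma rblockdiag_mul_mxcol (R : realType) (p q : nat -> nat)
    (B : forall i, 'M[R]_(p i, q i)) (k : nat) (z : forall i, 'cV[R]_(q i)) :
  rblockdiag B k *m \mxcol_(i < k) z i = \mxcol_(i < k) (B i *m z i).
Proof.
rewrite mul_mxblock_mxrow; apply: eq_mxcol => i.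
rewrite (bigD1 i) //= eqxx conform_mx_id big1 ?addr0 // => j ji.
by rewrite eq_sym (negbTE ji) mul0mx.
Qed.

Lemma castmx_mulmx (R : realType) (a a' b b' : nat) (ea : a = a') (eb : b = b')
    (M : 'M[R]_(a, b)) (v : 'cV[R]_b) :
  castmx (ea, eb) M *m castmx (eb, erefl) v = castmx (ea, erefl) (M *m v).
Proof. by case: a' / ea; case: b' / eb; rewrite !castmx_id. Qed.

Lemma castmxB (R : realType) (a a' : nat) (ea : a = a') (u v : 'cV[R]_a) :
  castmx (ea, erefl) u - castmx (ea, erefl) v = castmx (ea, erefl) (u - v).
Proof. by case: a' / ea; rewrite !castmx_id. Qed.

Lemma castmx_dot (R : realType) (a a' : nat) (ea : a = a') (u v : 'cV[R]_a) :
  (castmx (ea, erefl) u)^T *m castmx (ea, erefl) v = u^T *m v.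
Proof. by case: a' / ea; rewrite !castmx_id. Qed.

Lemma U1mx_mul (R : realType) (n a r : nat) (d : 'cV[R]_n) (y : 'cV[R]_a)
    (z : 'cV[R]_r) :
  U1mx R n a r *m col_mx d (col_mx y z) = col_mx d z.
Proof.
by rewrite mul_col_mx !mul_row_col !mul1mx !mul0mx !(add0r, addr0).
Qed.

Lemma U2mx_mul (R : realType) (n a r : nat) (d : 'cV[R]_n) (y : 'cV[R]_a)
    (z : 'cV[R]_r) :
  U2mx R n a r *m col_mx d (col_mx y z) = col_mx (col_mx d y) (col_mx y z).
Proof.
by rewrite !mul_col_mx !mul_row_col !mul1mx !mul0mx !(add0r, addr0).
Qed.

Lemma bilin_tr (R : realType) (p q : nat) (u : 'cV[R]_p) (M : 'M[R]_(p, q))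
    (v : 'cV[R]_q) :
  (u^T *m M *m v) 0 0 = (v^T *m M^T *m u) 0 0.
Proof.
have -> : v^T *m M^T *m u = (u^T *m M *m v)^T.
  by rewrite !trmx_mul trmxK mulmxA.
by rewrite [RHS]mxE.
Qed.

Lemma block_quadE (R : realType) (p q : nat) (u : 'cV[R]_p) (v : 'cV[R]_q)
    (E : 'M[R]_p) (F : 'M[R]_(p, q)) (G : 'M[R]_(q, p)) (H : 'M[R]_q) :
  (col_mx u v)^T *m block_mx E F G H *m col_mx u v =
  u^T *m E *m u + u^T *m F *m v + v^T *m G *m u + v^T *m H *m v.
Proof.
rewrite tr_col_mx mul_row_block mul_row_col !mulmxDl.
by rewrite -!addrA; congr (_ + _); rewrite addrCA.
Qed.

(** This is an identity of values of quadratic forms: expanding the product gives one cross term in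
    [Q1] and one in [Q2], and each, being a scalar, equals its transpose, hence half of the two
    matching terms of the symmetric off-diagonal blocks. *)
Lemma sector_quadE (R : realType) (p q : nat) (Q1 Q2 : 'M[R]_(q, p))
    (u : 'cV[R]_p) (v : 'cV[R]_q) :
  ((col_mx u v)^T *m block_mx (- 2 *: (Q1^T *m Q2)) (Q1^T + Q2^T)
                              (Q1 + Q2) (- 2)%:M *m col_mx u v) 0 0 =
  - 2 * ((v - Q1 *m u)^T *m (v - Q2 *m u)) 0 0.
Proof.
have -> : (v - Q1 *m u)^T *m (v - Q2 *m u) =
    v^T *m v - v^T *m Q2 *m u - u^T *m Q1^T *m v + u^T *m (Q1^T *m Q2) *m u.
  have -> : (v - Q1 *m u)^T = v^T - u^T *m Q1^T by rewrite linearB /= trmx_mul.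
  by rewrite mulmxBl !mulmxBr !mulmxA opprB addrA addrAC.
have e1 := bilin_tr u Q2^T v; rewrite trmxK in e1.
have e2 := bilin_tr u Q1^T v; rewrite trmxK in e2.
rewrite block_quadE mul_mx_scalar -scalemxAl -scalemxAr -scalemxAl.
rewrite !(mulmxDl, mulmxDr).
have DE (X Y : 'M[R]_1) : (X + Y) 0 0 = X 0 0 + Y 0 0 by rewrite mxE.
have NE (X : 'M[R]_1) : (- X) 0 0 = - X 0 0 by rewrite mxE.
have ZE c (X : 'M[R]_1) : (c *: X) 0 0 = c * X 0 0 by rewrite mxE.
rewrite !(DE, NE, ZE) e1 e2.
ring.
Qed.

(** * The matrix inequality along two network inputs *)

(** The inner product is a sum over the neurons of the layer, and each summand is the sector product
    at the preactivations of [x] and [y]; the bias cancels in their difference. *)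
Lemma sector_layer_le0 (R : realType) (m : nat -> nat)
    (W : forall i, 'M[R]_(m i.+1, m i)) (b : forall i, 'cV[R]_(m i.+1))
    (phi : forall i, 'I_(m i.+1) -> R -> R) (k : nat)
    (D : set 'cV[R]_(m 0%N)) (alpha beta : forall i, 'rV[R]_(m i.+1)) :
  inc_sector_bounded W b phi k D alpha beta ->
  forall (x y : 'cV[R]_(m 0%N)), D x -> D y -> 
  forall z : (forall i, 'cV[R]_(m i)),
  (forall i, z i = hidden W b phi x i - hidden W b phi y i) ->
  forall i, (i < k)%N ->
  ((z i.+1 - diag_mx (alpha i) *m W i *m z i)^T
     *m (z i.+1 - diag_mx (beta i) *m W i *m z i)) 0 0 <= 0.
Proof.
move=> hs x y Dx Dy z zE i ik; rewrite mxE; apply: sumr_le0 => j _.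
have [_ /(_ _ _ (ex_intro2 _ _ x Dx erefl) (ex_intro2 _ _ y Dy erefl))] :=
  hs i j ik.
have -> : preact W b (hidden W b phi x i) j 0 -
          preact W b (hidden W b phi y i) j 0 = (W i *m z i) j 0.
  by rewrite /preact zE mulmxBr !mxE; ring.
by rewrite -!mulmxA !mul_diag_mx (zE i.+1) !mxE.
Qed.

(** The sector term is nonnegative at stacked layer differences whatever the first block matrix is,
    so [E], [F] and [G] stay arbitrary. *)
Lemma lmi_incremental (R : realType) (k : nat) (k1 : (1 < k)%N) (m : nat -> nat)
    (W : forall i, 'M[R]_(m i.+1, m i)) (b : forall i, 'cV[R]_(m i.+1))
    (phi : forall i, 'I_(m i.+1) -> R -> R)
    (D : set 'cV[R]_(m 0%N)) (alpha beta : forall i, 'rV[R]_(m i.+1))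
    (E : 'M[R]_(m 0%N)) (F : 'M[R]_(m 0%N, m k)) (G : 'M[R]_(m k, m 0%N)) :
  inc_sector_bounded W b phi k D alpha beta ->
  (let Q1 := Qmx k1 W alpha in
   let Q2 := Qmx k1 W beta in
   let U1 := U1mx R (m 0%N) (midsize m k) (m k) in
   let U2 := U2mx R (m 0%N) (midsize m k) (m k) in
   mxle (U1^T *m block_mx E F G 0 *m U1
         + U2^T *m block_mx (- 2 *: (Q1^T *m Q2)) (Q1^T + Q2^T)
                            (Q1 + Q2)             (- 2)%:M *m U2) 0) ->
  forall x y, D x -> D y ->
  forall d z, d = x - y -> z = hidden W b phi x k - hidden W b phi y k ->
  (d^T *m E *m d + d^T *m F *m z + z^T *m G *m d) 0 0 <= 0.
Proof.
move=> hs lmi x y Dx Dy d zk dE zkE.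
pose z i := hidden W b phi x i - hidden W b phi y i.
have [v [hv1 hv2]] := mxcol_stack_shift k1 z.
(* Layer 0 of [hidden] is the input itself, so [z 0] is [x - y] by computation. *)
rewrite -[z k]zkE in hv2; rewrite -[z 0%N]dE in hv1.
have {lmi} := lmi (col_mx d (col_mx v zk)).
rewrite subr0 mulmxDr mulmxDl mxE.
have conj (p q : nat) (M : 'M[R]_q) (U : 'M[R]_(q, p)) (w : 'cV[R]_p) :
    w^T *m (U^T *m M *m U) *m w = (U *m w)^T *m M *m (U *m w).
  by rewrite trmx_mul !mulmxA.
rewrite !conj U1mx_mul U2mx_mul sector_quadE block_quadE mulmx0 mul0mx addr0.
suff : ((col_mx v zk - Qmx k1 W alpha *m col_mx d v)^T *m
        (col_mx v zk - Qmx k1 W beta *m col_mx d v)) 0 0 <= 0.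
  set q := _ 0 0; set r := _ 0 0; lra.
(* With both stacks written as casts, all casts merge into one, which the inner product absorbs;
   what remains splits into a sum over the layers. *)
rewrite -hv1 -hv2 /Qmx !castmx_mulmx !castmxB castmx_dot.
rewrite !rblockdiag_mul_mxcol -!mxcolB tr_mxcol mul_mxrow_mxcol.
rewrite summxE; apply: sumr_le0 => i _.
exact: (sector_layer_le0 hs Dx Dy (z := z)).
Qed.

(** * Derivatives of quadratic forms and a comparison principle *)

Lemma is_derive_coord (R : realType) (p q : nat) (x : R -> 'M[R]_(p, q)) (t : R)
    (dx : 'M[R]_(p, q)) (i : 'I_p) (j : 'I_q) :
  is_derive t 1 x dx -> is_derive t 1 (fun s => x s i j) (dx i j).
Proof.
move=> [dvx <-]; rewrite derive_mx // mxE.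
exact/derivableP/(derivable_mxP x t 1).1.
Qed.

Lemma is_derive_mulmx (R : realType) (p q r : nat) (u : R -> 'M[R]_(p, q))
    (v : R -> 'M[R]_(q, r)) (t : R) (du : 'M[R]_(p, q)) (dv : 'M[R]_(q, r))
    (i : 'I_p) (j : 'I_r) :
  is_derive t 1 u du -> is_derive t 1 v dv ->
  is_derive t 1 (fun s => (u s *m v s) i j) ((du *m v t + u t *m dv) i j).
Proof.
move=> hu hv.
have -> : (fun s => (u s *m v s) i j) =
    \sum_(l < q) ((fun s => u s i l) * (fun s => v s l j)).
  by apply/funext => s; rewrite mxE fct_sumE.
apply: (is_derive_eq (is_derive_sum (fun l =>
  is_deriveM (is_derive_coord i l hu) (is_derive_coord l j hv)))).
rewrite !mxE -big_split; apply: eq_bigr => l _ /=.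
by rewrite addrC; congr (_ + _); rewrite /GRing.scale /= // mulrC.
Qed.

Lemma is_derive_quad (R : realType) (n : nat) (P : 'M[R]_n) (x : R -> 'cV[R]_n)
    (c : 'cV[R]_n) (t : R) (dx : 'cV[R]_n) :
  is_derive t 1 x dx ->
  is_derive t 1 (fun s => ((x s - c)^T *m P *m (x s - c)) 0 0)
    ((dx^T *m P *m (x t - c) + (x t - c)^T *m P *m dx) 0 0).
Proof.
move=> hx.
have hd : is_derive t 1 (fun s => x s - c) dx.
  by apply: is_derive_eq; rewrite subr0.
have hl : is_derive t 1 (fun s => (x s - c)^T *m P) (dx^T *m P).
  have dE i j : is_derive t 1 (fun s => ((x s - c)^T *m P) i j)
                              ((dx^T *m P) i j).
    (* Transposing turns the factor into a constant matrix times [x s - c], to which the product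
       rule applies. *)
    have -> : (fun s => ((x s - c)^T *m P) i j) =
              (fun s => (P^T *m (x s - c)) j i).
      by apply/funext => s; rewrite -[P in LHS]trmxK -trmx_mul mxE.
    apply: (is_derive_eq (is_derive_mulmx j i (is_derive_cst P^T t 1) hd)).
    by rewrite mul0mx add0r -[P in RHS]trmxK -trmx_mul [RHS]mxE.
  have dl : derivable (fun s => (x s - c)^T *m P) t 1.
    by apply/derivable_mxP => i j; case: (dE i j).
  split => //; rewrite derive_mx //; apply/matrixP => i j; rewrite mxE.
  by case: (dE i j).
exact: (is_derive_mulmx 0 0 hl hd).
Qed.

(** For [h > 0], [x h] is [h] times the difference quotient plus [x 0]. This supplies the continuity
    at the initial time, where a trajectory has only a right derivative. *)
Lemma right_derivative_cvg (R : realType) (V : normedModType R) (x : R -> V)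
    (l : V) :
  (fun h : R => h^-1 *: (x h - x 0)) @ 0^'+ --> l -> x h @[h --> 0^'+] --> x 0.
Proof.
move=> hl.
have h0 : (h : R) @[h --> 0^'+] --> 0 by exact: cvg_at_right_filter.
have hx : h *: (h^-1 *: (x h - x 0)) + x 0 @[h --> 0^'+] --> 0 *: l + x 0.
  by apply: cvgD; [exact: cvgZ|exact: cvg_cst].
rewrite scale0r add0r in hx.
apply: (cvg_trans _ hx); apply: near_eq_cvg.
by near=> h; rewrite /= scalerA divff ?scale1r ?subrK // gt_eqF.
Unshelve. all: by end_near. Qed.

Lemma cvg_quad (R : realType) (n : nat) (P : 'M[R]_n) (c : 'cV[R]_n)
    (T : Type) (G : set_system T) (FG : Filter G) (x : T -> 'cV[R]_n)
    (l : 'cV[R]_n) :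
  x @ G --> l ->
  (fun s => ((x s - c)^T *m P *m (x s - c)) 0 0) @ G -->
    ((l - c)^T *m P *m (l - c)) 0 0.
Proof.
move=> hx.
have coord i : (fun s => (x s - c) i 0) @ G --> (l - c) i 0.
  under eq_fun do rewrite mxE.
  rewrite mxE; apply: cvgD; last exact: cvg_cst.
  exact: (cvg_comp _ _ hx (@coord_continuous _ _ _ i 0 l)).
have qE (d : 'cV[R]_n) :
    (d^T *m P *m d) 0 0 = \sum_j (\sum_i d i 0 * P i j) * d j 0.
  by rewrite mxE; apply: eq_bigr => j _; rewrite mxE; congr (_ * _);
    apply: eq_bigr => i _; rewrite mxE.
under eq_fun do rewrite qE.
rewrite qE; apply: cvg_big => [|j _]; first exact: add_continuous.
apply: cvgM => //; apply: cvg_big => [|i _]; first exact: add_continuous.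
by apply: cvgM => //; exact: cvg_cst.
Qed.

(** Formally [Y = sqrt V] satisfies [Y' <= - (g / 2) Y + r], whose equilibrium is [2 r / g]; hence
    [(Y - 2 r / g) exp (g t / 2)] does not increase. *)
Lemma sqrt_comparison (R : realType) (V dV : R -> R) (g r : R) :
  0 < g -> 0 <= r -> (forall t, 0 <= V t) ->
  V h @[h --> 0^'+] --> V 0 ->
  (forall t : R, 0 < t -> is_derive t 1 V (dV t)) ->
  (forall t : R, 0 < t -> dV t <= - g * V t + 2 * r * Num.sqrt (V t)) ->
  forall t : R, 0 <= t ->
  Num.sqrt (V t) <= Num.sqrt (V 0) * expR (- (g / 2) * t)
                    + 2 * r / g * (1 - expR (- (g / 2) * t)).
Proof.
move=> g0 r0 V0 cV hV hdV t; rewrite le_eqVlt => /predU1P[<-|t0].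
  by rewrite mulr0 expR0 subrr mulr0 addr0 mulr1.
apply/ler_addgt0Pr => e e0.
(* V is shifted by d ^+ 2 because sqrt is not differentiable where V vanishes. *)
pose d : R := e / 2; have d0 : 0 < d by rewrite divr_gt0.
pose Y (s : R) : R := Num.sqrt (V s + d ^+ 2).
have Vd0 s : 0 < V s + d ^+ 2 by rewrite ltr_wpDl // exprn_gt0.
have Y0 s : 0 < Y s by rewrite sqrtr_gt0.
have Y2 s : Y s ^+ 2 = V s + d ^+ 2 by rewrite sqr_sqrtr // ltW.
have dY s : d <= Y s.
  by rewrite -[leLHS]ger0_norm ?(ltW d0) // -sqrtr_sqr ler_wsqrtr // lerDr.
have VY s : Num.sqrt (V s) <= Y s by rewrite ler_wsqrtr // lerDl sqr_ge0.
(* The equilibrium is raised by [d] to absorb the error [g * d ^+ 2] that the shift of [V]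
   causes. *)
pose c := 2 * r / g + d.
pose G (s : R) : R := (Y s - c) * expR (g / 2 * s).
have dG (s : R) : 0 < s -> is_derive s 1 G
   (expR (g / 2 * s) * (dV s / (2 * Y s) + (g / 2) * (Y s - c))).
  move=> s0; have hVs := hV s s0.
  have hVd : is_derive s 1 (fun u => V u + d ^+ 2) (dV s).
    by apply: is_derive_eq; rewrite addr0.
  have hY : is_derive s 1 Y ((2 * Y s)^-1 * dV s).
    exact: (is_derive1_comp (g := fun u => V u + d ^+ 2) (is_derive1_sqrt (Vd0 s)) hVd).
  have hlin : is_derive s 1 (fun u => g / 2 * u) (g / 2).
    by apply: is_derive_eq; rewrite /GRing.scale /= mulr1.
  have hE : is_derive s 1 (fun u => expR (g / 2 * u)) (expR (g / 2 * s) * (g / 2)).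
    exact: (is_derive1_comp (g := fun u => g / 2 * u) (is_derive_expR _) hlin).
  have hYc : is_derive s 1 (fun u => Y u - c) ((2 * Y s)^-1 * dV s).
    by apply: is_derive_eq; rewrite subr0.
  apply: (is_derive_eq (is_deriveM hYc hE)).
  rewrite /GRing.scale /=; ring.
have cY0 : Y h @[h --> 0^'+] --> Y 0.
  have hV0 : V h + d ^+ 2 @[h --> 0^'+] --> V 0 + d ^+ 2.
    by apply: cvgD => //; exact: cvg_cst.
  exact: (cvg_comp _ _ hV0 (@sqrt_continuous _ (V 0 + d ^+ 2))).
have cG0 : G h @[h --> 0^'+] --> G 0.
  apply: cvgM; first by apply: cvgB => //; exact: cvg_cst.
  have hl : g / 2 * h @[h --> 0^'+] --> g / 2 * 0.
    by apply: cvgM; [exact: cvg_cst|exact: cvg_at_right_filter].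
  exact: (cvg_comp _ _ hl (@continuous_expR _ (g / 2 * 0))).
have cG (s : R) : 0 < s -> {for s, continuous G}.
  move=> s0; apply: differentiable_continuous; apply/derivable1_diffP.
  by case: (dG s s0).
have Gt0 : G t <= G 0.
  apply: (@ler0_derive1_le_cc _ G 0 t) => //.
  - by move=> s /itvP ss; case: (dG s) => //; rewrite ss.
  - move=> s /itvP ss; rewrite derive1E.
    have s0 : 0 < s by rewrite ss.
    rewrite (@derive_val _ _ _ _ _ _ _ (dG s s0)).
    rewrite pmulr_rle0 ?expR_gt0 //.
    have Ys0 := Y0 s.
    (* Once the denominator is cleared, [Y ^+ 2 = V + d ^+ 2] and the bound on [dV] leave at most
       [2 r (sqrt V - Y) + g d (d - Y)], and both summands are nonpositive. *)
    rewrite -(pmulr_rle0 _ (_ : 0 < 2 * Y s)) ?mulr_gt0 //.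
    rewrite mulrDr mulrCA divff ?mulr1; last by rewrite gt_eqF ?mulr_gt0.
    have -> : 2 * Y s * (g / 2 * (Y s - c)) =
        g * (Y s ^+ 2) - 2 * r * Y s - g * d * Y s.
      by rewrite /c; field; rewrite gt_eqF.
    rewrite Y2; have := hdV s s0; have := VY s; have := dY s.
    move=> h1 h2 h3.
    have : r * Num.sqrt (V s) <= r * Y s by rewrite ler_wpM2l.
    have : g * d * d <= g * d * Y s by rewrite ler_wpM2l // mulr_ge0 // ltW.
    rewrite expr2; nra.
  - apply/continuous_within_itvP => //; split => //.
    + by move=> s /itvP ss; apply: cG; rewrite ss.
    + by apply: cvg_at_left_filter; exact: cG.
  - by rewrite bound_itvE ltW.
  - by rewrite bound_itvE ltW.
  - exact: ltW.
rewrite /G mulr0 expR0 mulr1 -ler_pdivlMr ?expR_gt0 // -expRN -mulNr in Gt0.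
have Y0V : Y 0 <= Num.sqrt (V 0) + d.
  have sd : 0 <= Num.sqrt (V 0) + d by rewrite addr_ge0 ?sqrtr_ge0 // ltW.
  rewrite -ler_sqr ?nnegrE ?(ltW (Y0 0)) // Y2 sqrrD sqr_sqrtr // lerD2r lerDl.
  by rewrite mulrn_wge0 // mulr_ge0 ?sqrtr_ge0 // ltW.
have E0 : 0 < expR (- (g / 2) * t) by exact: expR_gt0.
have E1 : expR (- (g / 2) * t) <= 1.
  by rewrite -expR0 ler_expR mulNr oppr_le0 mulr_ge0 // ltW // divr_gt0.
have := VY t; move: Gt0 Y0V E0 E1.
rewrite /c [e](_ : e = d + d); last by rewrite -splitr.
set a := expR _; set q := 2 * r / g => h1 h2 h3 h4 h5.
(* The [d] in the bound on [Y 0] cancels the one in [c]; only the [d] added back with [c] remains,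
   and it is below [e]. *)
have h6 : (Y 0 - (q + d)) * a <= (Num.sqrt (V 0) + d - (q + d)) * a.
  by rewrite ler_pM2r // lerB.
lra.
Qed.

(** * Lyapunov estimate *)

Lemma posdef_ge0 (R : realType) (n : nat) (P : 'M[R]_n) (u : 'cV[R]_n) :
  posdef P -> 0 <= (u^T *m P *m u) 0 0.
Proof.
move=> [_ hP]; have [->|u0] := eqVneq u 0; first by rewrite mulmx0 mxE.
exact/ltW/hP.
Qed.

Lemma posdef_cauchy_schwarz (R : realType) (n : nat) (P : 'M[R]_n)
    (u v : 'cV[R]_n) :
  posdef P ->
  (u^T *m P *m v) 0 0 <=
    Num.sqrt ((u^T *m P *m u) 0 0) * Num.sqrt ((v^T *m P *m v) 0 0).
Proof.
move=> hP; have [v0|v0] := eqVneq v 0.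
  by rewrite v0 mulmx0 mxE mulr_ge0 ?sqrtr_ge0.
have Pv : 0 < (v^T *m P *m v) 0 0 by apply: hP.2.
have Puv : (v^T *m P *m u) 0 0 = (u^T *m P *m v) 0 0 by rewrite bilin_tr hP.1.
set a := (v^T *m P *m v) 0 0 in Pv *.
set b := (u^T *m P *m v) 0 0 in Puv *.
(* The polynomial in [c] is the form of [P] at [u - c *: v]; it is smallest at [c = b / a], where
   the nonnegative value is [u^T P u - b ^+ 2 / a]. *)
have /(_ (b / a)) h c : 0 <= (u^T *m P *m u) 0 0 - 2 * c * b + c ^+ 2 * a.
  have := posdef_ge0 (u - c *: v) hP.
  have -> : (u - c *: v)^T = u^T - c *: v^T by rewrite linearB linearZ.
  rewrite !(mulmxBl, mulmxBr) -!(scalemxAl, scalemxAr).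
  have BE (X Y : 'M[R]_1) : (X - Y) 0 0 = X 0 0 - Y 0 0 by rewrite !mxE.
  have ZE e (X : 'M[R]_1) : (e *: X) 0 0 = e * X 0 0 by rewrite mxE.
  rewrite !(BE, ZE) Puv -/a -/b; congr (0 <= _); ring.
have hb : b ^+ 2 <= (u^T *m P *m u) 0 0 * a.
  rewrite -ler_pdivrMr // -subr_ge0; apply: le_trans h _.
  by rewrite le_eqVlt; apply/orP; left; apply/eqP; field; rewrite gt_eqF.
rewrite -sqrtrM ?posdef_ge0 //; apply: le_trans (ler_norm b) _.
by rewrite -sqrtr_sqr ler_wsqrtr.
Qed.

Lemma enorm_sqr (R : realType) (n : nat) (v : 'cV[R]_n) :
  enorm v ^+ 2 = (v^T *m v) 0 0.
Proof.
rewrite /enorm sqr_sqrtr; last by apply: sumr_ge0 => i _; exact: sqr_ge0.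
by rewrite mxE; apply: eq_bigr => i _; rewrite mxE expr2.
Qed.

(** Coordinatewise, the gap between the two sides is [(u_i + v_i) ^+ 2]. For two vectors of norm at
    most [eps] this yields [(2 eps) ^+ 2], as the triangle inequality would. *)
Lemma enorm_sqrB (R : realType) (n : nat) (u v : 'cV[R]_n) :
  enorm (u - v) ^+ 2 <= 2 * enorm u ^+ 2 + 2 * enorm v ^+ 2.
Proof.
rewrite /enorm !sqr_sqrtr; try by apply: sumr_ge0 => i _; exact: sqr_ge0.
rewrite !mulr_sumr -big_split; apply: ler_sum => i _ /=; rewrite !mxE.
have := sqr_ge0 (u i 0 + v i 0); rewrite !expr2; lra.
Qed.

Lemma mxle_quad (R : realType) (n : nat) (B C : 'M[R]_n) (v : 'cV[R]_n) :
  mxle B C -> (v^T *m B *m v) 0 0 <= (v^T *m C *m v) 0 0.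
Proof. by move=> /(_ v); rewrite mulmxBr mulmxBl !mxE subr_le0. Qed.

Lemma scalar_quadE (R : realType) (n : nat) (a : R) (v : 'cV[R]_n) :
  (v^T *m a%:M *m v) 0 0 = a * enorm v ^+ 2.
Proof. by rewrite mul_mx_scalar -scalemxAl mxE enorm_sqr. Qed.

(** Here [f] stands for the derivative of the error [d]. Its [A] and [Wout] parts reproduce the
    hypothesis up to [gamma P], and the two terms in [e] coincide by symmetry of [P]. *)
Lemma closed_loop_quad_le (R : realType) (n r : nat) (A P : 'M[R]_n)
    (Wout : 'M[R]_(n, r)) (g : R) (d e : 'cV[R]_n) (z : 'cV[R]_r) :
  P^T = P ->
  (d^T *m (A^T *m P + P *m A + g *: P) *m d + d^T *m (P *m Wout) *m z
   + z^T *m (Wout^T *m P) *m d) 0 0 <= 0 ->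
  forall f, f = A *m d + Wout *m z + e ->
  (f^T *m P *m d + d^T *m P *m f) 0 0 <=
    - g * (d^T *m P *m d) 0 0 + 2 * (d^T *m P *m e) 0 0.
Proof.
move=> Psym h f fE.
have fT : f^T = d^T *m A^T + z^T *m Wout^T + e^T.
  by rewrite fE !linearD /= !trmx_mul.
have Pe : (e^T *m P *m d) 0 0 = (d^T *m P *m e) 0 0 by rewrite bilin_tr Psym.
have DE (X Y : 'M[R]_1) : (X + Y) 0 0 = X 0 0 + Y 0 0 by rewrite mxE.
have ZE c (X : 'M[R]_1) : (c *: X) 0 0 = c * X 0 0 by rewrite mxE.
move: h; rewrite fT fE !(mulmxDl, mulmxDr) -!(scalemxAl, scalemxAr) !mulmxA.
rewrite !(DE, ZE) Pe; lra.
Qed.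

Theorem mainTheorem5
  (R : realType) (k : nat) (k1 : (1 < k)%N) (m : nat -> nat)
  (* k-hidden-layer network, n = m 0 *)
  (W : forall i, 'M[R]_(m i.+1, m i)) (b : forall i, 'cV[R]_(m i.+1))
  (phi : forall i, 'I_(m i.+1) -> R -> R)
  (Wout : 'M[R]_(m 0%N, m k)) (bout : 'cV[R]_(m 0%N))
  (hphi : forall i (j : 'I_(m i.+1)) (s : R),
     (i < k)%N -> derivable (phi i j) s 1)
  (D : set 'cV[R]_(m 0%N))
  (alpha beta : forall i, 'rV[R]_(m i.+1))
  (hsector : inc_sector_bounded W b phi k D alpha beta)
  (A : 'M[R]_(m 0%N)) (err : 'cV[R]_(m 0%N) -> 'cV[R]_(m 0%N))
  (C : set 'cV[R]_(m 0%N)) (CD : C `<=` D)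
  (hC : forward_complete_invariant
     (fun x => A *m x + network W b phi Wout bout x) C)
  (eps : R)
  (heps : ereal_sup [set (enorm (err x))%:E | x in D] = eps%:E)
  (B : set 'cV[R]_(m 0%N)) (BC : B `<=` C)
  (hB : remains_in
     (fun x => A *m x + network W b phi Wout bout x + err x) B C)
  (xs : 'cV[R]_(m 0%N)) (hxsC : C xs)
  (hxs : A *m xs + network W b phi Wout bout xs + err xs = 0)
  (P : 'M[R]_(m 0%N)) (hP : posdef P)
  (pl pu gamma : R) (hpl : 0 < pl) (hpu : 0 < pu) (hgamma : 0 < gamma)
  (hPl : mxle pl%:M P) (hPu : mxle P pu%:M)
  (hLMI :
     let Q1 := Qmx k1 W alpha in
     let Q2 := Qmx k1 W beta in
     let U1 := U1mx R (m 0%N) (midsize m k) (m k) in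
     let U2 := U2mx R (m 0%N) (midsize m k) (m k) in
     mxle
       (U1^T *m block_mx (A^T *m P + P *m A + gamma *: P) (P *m Wout)
                         (Wout^T *m P)                    0 *m U1
        + U2^T *m block_mx (- 2 *: (Q1^T *m Q2)) (Q1^T + Q2^T)
                           (Q1 + Q2)             (- 2)%:M *m U2)
       0) :
  forall x : R -> 'cV[R]_(m 0%N),
    trajectory (fun y => A *m y + network W b phi Wout bout y + err y) x ->
    B (x 0) ->
    forall t : R, 0 <= t ->
      enorm (x t - xs) <=
        Num.sqrt (pu / pl) * enorm (x 0 - xs) * expR (- (gamma / 2) * t)
        + 4 * eps / gamma * Num.sqrt (pu / pl)
          * (1 - expR (- (gamma / 2) * t)).
Proof.
move=> x [hx0 hx] Bx t t0.
pose F y := A *m y + network W b phi Wout bout y + err y.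
have Cx (s : R) : 0 <= s -> C (x s).
  by apply: (hB _ Bx).2 => //; split.
have eps_ub y : D y -> enorm (err y) <= eps.
  by move=> Dy; rewrite -lee_fin -heps; apply: ereal_sup_ubound; exists y.
(* The equilibrium lies in [D], so [eps] dominates an actual norm. *)
have eps0 : 0 <= eps by apply: le_trans (eps_ub _ (CD _ hxsC)); exact: sqrtr_ge0.
pose V (s : R) : R := ((x s - xs)^T *m P *m (x s - xs)) 0 0.
pose dV (s : R) : R := ((F (x s))^T *m P *m (x s - xs)
              + (x s - xs)^T *m P *m F (x s)) 0 0.
(* This is the form required by [sqrt_comparison] with [r = 2 eps sqrt pu]: [2 eps] bounds the
   difference of two errors, and [sqrt pu] passes from the norm of [P] to [enorm]. *)
have dVle (s : R) : 0 < s ->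
    dV s <= - gamma * V s + 2 * (2 * eps * Num.sqrt pu) * Num.sqrt (V s).
  move=> s0; have Dxs := CD _ (Cx s (ltW s0)); have Dxs' := CD _ hxsC.
  pose e := err (x s) - err xs.
  have FE : F (x s) = A *m (x s - xs)
      + Wout *m (hidden W b phi (x s) k - hidden W b phi xs k) + e.
    (* The subtracted zero is the vector field at [xs], so the output bias cancels. *)
    rewrite -[F (x s)]subr0 -hxs /F /network /e !mulmxBr.
    by apply/matrixP => i j; rewrite !mxE; ring.
  rewrite /dV; apply: le_trans (closed_loop_quad_le hP.1 _ FE) _.
    exact: (lmi_incremental hsector hLMI Dxs Dxs').
  rewrite -/(V s) lerD2l -[leRHS]mulrA ler_pM2l //.
  apply: le_trans (posdef_cauchy_schwarz _ _ hP) _.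
  rewrite -/(V s) mulrC ler_wpM2r ?sqrtr_ge0 //.
  have -> : 2 * eps * Num.sqrt pu = Num.sqrt (pu * (2 * eps) ^+ 2).
    by rewrite sqrtrM ?(ltW hpu) // sqrtr_sqr ger0_norm ?mulr_ge0 // mulrC.
  rewrite ler_wsqrtr //; apply: le_trans (mxle_quad _ hPu) _.
  rewrite scalar_quadE ler_pM2l //; apply: le_trans (enorm_sqrB _ _) _.
  have h1 : enorm (err (x s)) ^+ 2 <= eps ^+ 2.
    by rewrite ler_sqr ?nnegrE ?sqrtr_ge0 // eps_ub.
  have h2 : enorm (err xs) ^+ 2 <= eps ^+ 2.
    by rewrite ler_sqr ?nnegrE ?sqrtr_ge0 // eps_ub.
  rewrite exprMn; lra.
have cV : V h @[h --> 0^'+] --> V 0.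
  by apply: cvg_quad; exact: right_derivative_cvg hx0.
have hV (s : R) : 0 < s -> is_derive s 1 V (dV s).
  by move=> s0; exact: is_derive_quad (hx s s0).
have r0 : 0 <= 2 * eps * Num.sqrt pu by rewrite !mulr_ge0 ?sqrtr_ge0.
have V0 s : 0 <= V s by exact: posdef_ge0.
have hle := sqrt_comparison hgamma r0 V0 cV hV dVle t0.
have lowV s : Num.sqrt pl * enorm (x s - xs) <= Num.sqrt (V s).
  rewrite -[enorm _]ger0_norm ?sqrtr_ge0 // -sqrtr_sqr -sqrtrM ?(ltW hpl) //.
  by rewrite ler_wsqrtr // -scalar_quadE mxle_quad.
have upV s : Num.sqrt (V s) <= Num.sqrt pu * enorm (x s - xs).
  rewrite -[enorm _]ger0_norm ?sqrtr_ge0 // -sqrtr_sqr -sqrtrM ?(ltW hpu) //.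
  by rewrite ler_wsqrtr // -scalar_quadE mxle_quad.
have spl0 : 0 < Num.sqrt pl by rewrite sqrtr_gt0.
(* Multiplying by [sqrt pl] lets the lower bound on [V] act at time [t]; the upper bound is then
   needed only at time 0. *)
rewrite -(ler_pM2l spl0); apply: le_trans (lowV t) _; apply: le_trans hle _.
set E := expR _.
have -> : Num.sqrt (pu / pl) = Num.sqrt pu / Num.sqrt pl.
  by rewrite sqrtrM ?(ltW hpu) // sqrtrV // ltW.
have -> : Num.sqrt pl * (Num.sqrt pu / Num.sqrt pl * enorm (x 0 - xs) * E
      + 4 * eps / gamma * (Num.sqrt pu / Num.sqrt pl) * (1 - E)) =
    Num.sqrt pu * enorm (x 0 - xs) * E
      + 2 * (2 * eps * Num.sqrt pu) / gamma * (1 - E).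
  by field; rewrite !gt_eqF.
by rewrite lerD2r ler_wpM2r ?expR_ge0.
Qed.
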